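(* For any general metric space $A$, there exists a $\mathcal{P}_1$-complete (respectively $\mathcal{P}_2$-complete) general metric space $\bar A$ together with a non-expansive map $i_A: A\to\bar A$ such that for any non-expansive map $f: A\to B$ with $B$ a $\mathcal{P}_1$-complete (respectively $\mathcal{P}_2$-complete) general metric space, there exists a unique non-expansive map $\bar f:\bar A\to B$ which preserves representatives of weakly flat filters (respectively representatives of flat filters) and satisfies $\bar f\circ i_A = f$.
   Context: A general metric space is a set $A$ with $A(-,-):A\times A\to[0,\infty]$ such that $A(x,x)=0$ and $A(y,z)+A(x,y)\ge A(x,z)$. A map $f:A\to B$ is non-expansive if $A(x,y)\ge B(f(x),f(y))$ for all $x,y$. Filters are proper (all members non-empty). A filter $\mathcal{F}$ on $A$ is weakly flat if for every $\epsilon>0$ there is $f\in\mathcal{F}$ such that for all $x\in f$ and $g\in\mathcal{F}$ there is $y\in g$ with $A(x,y)\le\epsilon$. It is flat if for every $\epsilon>0$ there is $f\in\mathcal{F}$ such that for every finite family $(x_i)$ in $f$ and every $g\in\mathcal{F}$ there is $y\in g$ with $A(x_i,y)\le\epsilon$ for all $i$. A filter $\mathcal{F}$ on $A$ has representative $x_0\in A$ if for all $a\in A$, $A(x_0,a)=\inf_{f\in\mathcal{F}}\sup_{x\in f}A(x,a)$. For a non-expansive $G:A\to B$, $G(\mathcal{F})$ is the filter on $B$ generated by the sets $G(f)$, $f\in\mathcal{F}$; $G$ preserves the representative $x_0$ of $\mathcal{F}$ if $G(x_0)$ is a representative of $G(\mathcal{F})$. $A$ is $\mathcal{P}_1$-complete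 (respectively $\mathcal{P}_2$-complete) if every weakly flat (respectively flat) filter on $A$ has a representative.
   Formalization: Uniqueness of f̄ is proved only up to distance 0 in both directions pointwise (equality when B is separated), since strict uniqueness fails for non-separated B: take A = ℕ ordered and B = ℕ with two equivalent top points, which can be swapped. *)

(* Defs.v *)
From mathcomp Require Import all_boot all_order all_algebra.
From mathcomp Require Import boolp classical_sets filter reals ereal.

Set Implicit Arguments.
Unset Strict Implicit.
Unset Printing Implicit Defensive.

Import Order.TTheory GRing.Theory Num.Theory.

Local Open Scope classical_set_scope.
Local Open Scope ring_scope.
Local Open Scope ereal_scope.

(* Neither symmetry nor separation is assumed, and the carrier may be empty. *)
Record gms (R : realType) := Gms {
  gms_sort :> Type;
  gdist : gms_sort -> gms_sort -> \bar R;
  gdist_ge0 : forall x y, 0 <= gdist x y;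
  gdist_xx : forall x, gdist x x = 0;
  gdist_triangle : forall x y z, gdist x z <= gdist y z + gdist x y }.

Definition nonexpansive (R : realType) (A B : gms R) (f : A -> B) : Prop :=
  forall x y, gdist (f x) (f y) <= gdist x y.

Definition weakly_flat (R : realType) (A : gms R) (F : set_system A) : Prop :=
  forall e : R, (0 < e)%R ->
    exists2 f, F f & forall x g, f x -> F g ->
      exists2 y, g y & gdist x y <= e%:E.

(* n = 0, the empty family, is allowed. *)
Definition flat (R : realType) (A : gms R) (F : set_system A) : Prop :=
  forall e : R, (0 < e)%R ->
    exists2 f, F f & forall (n : nat) (x : 'I_n -> A) g,
      (forall i, f (x i)) -> F g ->
      exists2 y, g y & forall i, gdist (x i) y <= e%:E.

Definition representative (R : realType) (A : gms R) (F : set_system A)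
    (x0 : A) : Prop :=
  forall a, gdist x0 a =
    ereal_inf [set ereal_sup [set gdist x a | x in f] | f in F].

Definition image_filter (A B : Type) (G : A -> B) (F : set_system A) :
    set_system B :=
  filter_from F (fun f => G @` f).

Definition P1_complete (R : realType) (A : gms R) : Prop :=
  forall F : set_system A, ProperFilter F -> weakly_flat F ->
    exists x0, representative F x0.

Definition P2_complete (R : realType) (A : gms R) : Prop :=
  forall F : set_system A, ProperFilter F -> flat F ->
    exists x0, representative F x0.

Definition preserves_weakly_flat_reps (R : realType) (A B : gms R)
    (G : A -> B) : Prop :=
  forall F : set_system A, ProperFilter F -> weakly_flat F ->
    forall x0, representative F x0 ->
      representative (image_filter G F) (G x0).

Definition preserves_flat_reps (R : realType) (A B : gms R)
    (G : A -> B) : Prop :=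
  forall F : set_system A, ProperFilter F -> flat F ->
    forall x0, representative F x0 ->
      representative (image_filter G F) (G x0).

(* Without separation a representative is determined only up to distance 0 in
   both directions, so maps that preserve representatives can be unique only up
   to this relation; it is equality as soon as B is separated. *)
Definition map_equiv (R : realType) (A B : gms R) (f g : A -> B) : Prop :=
  forall x, gdist (f x) (g x) = 0 /\ gdist (g x) (f x) = 0.

(* Main.v *)
Require Import Defs.
From mathcomp Require Import all_boot all_order all_algebra.
From mathcomp Require Import boolp classical_sets filter reals ereal.
From mathcomp Require Import lra.

(** The completion consists of the (weakly) flat filters on [A], where
    [d(F, G)] is the infimum of the [r] such that, for some [f] in [F], every
    point of [f] lies within [r] of every member of [G]. Thus [F] is weakly
    flat exactly when [d(F, F) = 0].  A flat filter [Phi] of flat filters is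
    represented by the filter generated by the sets of points [x] which, for
    each [e > 0], are [e]-approached by filters [X] in every member of [Phi].
    Points of [A] embed as principal filters, and every flat filter [F] is the
    representative of its own image under this embedding; hence a
    representative-preserving extension of [f] must send [F] to a
    representative of [f(F)], and any choice of such representatives works. *)

Set Implicit Arguments.
Unset Strict Implicit.
Unset Printing Implicit Defensive.

Import Order.TTheory GRing.Theory Num.Theory.

Local Open Scope classical_set_scope.
Local Open Scope ring_scope.
Local Open Scope ereal_scope.

(** * Flatness relative to a set of family sizes *)

(* Weak flatness and flatness are the cases [N = [set 1]] and [N = setT]. *)
Definition flat_arity (R : realType) (N : set nat) (A : gms R)
    (F : set_system A) : Prop :=
  forall e : R, (0 < e)%R ->
    exists2 f, F f & forall (n : nat) (x : 'I_n -> A) g,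
      N n -> (forall i, f (x i)) -> F g ->
      exists2 y, g y & forall i, gdist (x i) y <= e%:E.

(** Stated as an equality of functions of the space, so that it can rewrite below quantifiers over
    spaces and filters. *)
Lemma flat_arity_setT (R : realType) : @flat R = @flat_arity R setT.
Proof.
apply: functional_extensionality_dep => A; apply/funext => F.
apply/propext; split => flF e e0.
  by have [f Ff fP] := flF e e0; exists f => // n x g _; exact: fP.
by have [f Ff fP] := flF e e0; exists f => // n x g; exact: fP.
Qed.

Lemma flat_arity_weakly_flat (R : realType) (N : set nat) (A : gms R)
  (F : set_system A) : N 1%N -> flat_arity N F -> weakly_flat F.
Proof.
move=> N1 flF e e0; have [f Ff fP] := flF e e0; exists f => // x g fx Fg.
have [y gy yP] := fP 1%N (fun=> x) g N1 (fun=> fx) Fg.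
by exists y => //; exact: (yP ord0).
Qed.

Lemma flat_arity_set1 (R : realType) : @weakly_flat R = @flat_arity R [set 1%N].
Proof.
apply: functional_extensionality_dep => A; apply/funext => F.
apply/propext; split; last first.
  exact: flat_arity_weakly_flat.
move=> flF e e0; have [f Ff fP] := flF e e0; exists f => // n x g n1.
rewrite n1 in x * => fx Fg; have [y gy yP] := fP _ _ (fx ord0) Fg.
by exists y => // i; rewrite (ord1 i).
Qed.

Definition complete_arity (R : realType) (N : set nat) (A : gms R) : Prop :=
  forall F : set_system A, ProperFilter F -> flat_arity N F ->
    exists x0, representative F x0.

Definition preserves_reps_arity (R : realType) (N : set nat) (A B : gms R)
    (G : A -> B) : Prop :=
  forall F : set_system A, ProperFilter F -> flat_arity N F ->
    forall x0, representative F x0 ->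
      representative (image_filter G F) (G x0).

(** * Real bounds on extended distances, representatives and image filters *)

Lemma lee_of_lt_fin (R : realType) (u v : \bar R) :
  (forall r : R, v < r%:E -> u <= r%:E) -> u <= v.
Proof.
move=> uv; rewrite leNgt; apply/negP => vu.
case: v uv vu => [v| |] uv vu; last 2 first.
- by move: vu; rewrite ltNge leey.
- case: u uv vu => [u| |] uv vu //.
    have := uv (u - 1)%R (ltNyr _); rewrite lee_fin; lra.
  by have := uv 0%R (ltNyr _).
case: u uv vu => [u| |] uv vu //.
  have := uv ((u + v) / 2)%R; move: vu; rewrite !lte_fin lee_fin => vu h.
  have : (u <= (u + v) / 2)%R by apply: h; lra.
  lra.
have := uv (v + 1)%R; rewrite lte_fin => h.
have : +oo <= (v + 1)%:E by apply: h; lra.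
by [].
Qed.

Lemma gdist_triangle_le (R : realType) (A : gms R) (x y z : A) (r s : R) :
  gdist x y <= r%:E -> gdist y z <= s%:E -> gdist x z <= (r + s)%:E.
Proof.
move=> xy yz; apply: le_trans (gdist_triangle x y z) _.
by rewrite addrC EFinD leeD.
Qed.

(** The equation with the infimum of suprema splits into its two inequalities, each tested on real
    radii; this avoids all arithmetic with infinite values later. *)
Lemma representativeP (R : realType) (A : gms R) (F : set_system A) (x0 : A) :
  representative F x0 <->
  (forall a (r : R), gdist x0 a < r%:E ->
     exists2 f, F f & forall x, f x -> gdist x a <= r%:E) /\
  (forall a (r : R) f, F f -> (forall x, f x -> gdist x a <= r%:E) ->
     gdist x0 a <= r%:E).
Proof.
split => [repx0 | [ge_x0 le_x0] a].
  split=> [a r | a r f Ff fr]; rewrite repx0.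
    move=> /ereal_inf_lt [_ [f Ff <-] fr]; exists f => // x fx.
    by apply: le_trans (ltW fr); apply: ereal_sup_ubound; exists x.
  apply: (@le_trans _ _ (ereal_sup [set gdist x a | x in f])).
    by apply: ereal_inf_lbound; exists f.
  by apply: ge_ereal_sup => _ [x fx <-]; exact: fr.
apply/eqP; rewrite eq_le; apply/andP; split; apply: lee_of_lt_fin => r.
  move=> /ereal_inf_lt [_ [f Ff <-] fr]; apply: (le_x0 _ _ f) => // x fx.
  by apply: le_trans (ltW fr); apply: ereal_sup_ubound; exists x.
move=> /ge_x0 [f Ff fr].
apply: (@le_trans _ _ (ereal_sup [set gdist x a | x in f])).
  by apply: ereal_inf_lbound; exists f.
by apply: ge_ereal_sup => _ [x fx <-]; exact: fr.
Qed.

(** Distances out of [x0] and out of [x1] are given by the same formula, so the one to [x1] equals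
    [gdist x1 x1]. *)
Lemma representative_dist0 (R : realType) (A : gms R) (F : set_system A)
  (x0 x1 : A) : representative F x0 -> representative F x1 -> gdist x0 x1 = 0.
Proof. by move=> rep0 rep1; rewrite rep0 -rep1 gdist_xx. Qed.

Lemma representative_near (R : realType) (A : gms R) (F : set_system A)
  (x0 : A) (e : R) : representative F x0 -> (0 < e)%R ->
  exists2 f, F f & forall x, f x -> gdist x x0 <= e%:E.
Proof.
move=> /representativeP[ge_x0 _] e0.
by apply: ge_x0; rewrite gdist_xx lte_fin.
Qed.

Lemma image_filter_proper (R : realType) (A B : gms R) (G : A -> B)
  (F : set_system A) : ProperFilter F -> ProperFilter (image_filter G F).
Proof.
move=> PF; apply: filter_from_proper; last first.
  by move=> f /filter_ex[x fx]; exists (G x); exists x.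
apply: filter_from_filter; first by exists setT; exact: filterT.
move=> f g Ff Fg; exists (f `&` g); first exact: filterI.
by move=> _ [x [fx gx] <-]; split; exists x.
Qed.

Lemma image_filter_flat (R : realType) (N : set nat) (A B : gms R) (G : A -> B)
  (F : set_system A) : nonexpansive G -> flat_arity N F ->
  flat_arity N (image_filter G F).
Proof.
move=> neG flF e e0; have [f Ff fP] := flF e e0.
exists (G @` f); first by exists f.
move=> n x g Nn fx [h Fh hg].
have /choice[z zP] : forall i, exists z, f z /\ G z = x i.
  by move=> i; have [z] := fx i; exists z.
have [y hy yP] := fP n z h Nn (fun i => (zP i).1) Fh.
exists (G y); first by apply: hg; exists y.
by move=> i; rewrite -(zP i).2; apply: le_trans (neG _ _) (yP i).
Qed.

Lemma image_filter_representative (R : realType) (A B : gms R) (G : A -> B)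
  (F : set_system A) (b0 : B) :
  representative (image_filter G F) b0 <->
  (forall b (r : R), gdist b0 b < r%:E ->
     exists2 f, F f & forall x, f x -> gdist (G x) b <= r%:E) /\
  (forall b (r : R) f, F f -> (forall x, f x -> gdist (G x) b <= r%:E) ->
     gdist b0 b <= r%:E).
Proof.
rewrite representativeP; split=> -[ge_b0 le_b0]; split=> b r.
- move=> /ge_b0 [g [f Ff fg] gr]; exists f => // x fx.
  by apply: gr; apply: fg; exists x.
- move=> f Ff fr; apply: (le_b0 _ _ (G @` f)); first by exists f.
  by move=> _ [x fx <-]; exact: fr.
- move=> /ge_b0 [f Ff fr]; exists (G @` f); first by exists f.
  by move=> _ [x fx <-]; exact: fr.
- move=> g [f Ff fg] gr; apply: (le_b0 _ _ f) => // x fx.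
  by apply: gr; apply: fg; exists x.
Qed.

(** * The distance between filters *)

Definition approaches (R : realType) (A : gms R) (G : set_system A) (x : A)
    (r : R) : Prop :=
  forall g, G g -> exists2 y, g y & gdist x y <= r%:E.

(** For an upward closed [F], having a member all of whose points approach [G] amounts to containing
    the set of all such points. *)
Definition filter_near (R : realType) (A : gms R) (F G : set_system A)
    (r : R) : Prop :=
  F [set x | approaches G x r].

Definition filter_dist (R : realType) (A : gms R) (F G : set_system A) :
    \bar R :=
  ereal_inf [set r%:E | r in filter_near F G].

Lemma approaches_le (R : realType) (A : gms R) (G : set_system A) (x : A)
  (r s : R) : (r <= s)%R -> approaches G x r -> approaches G x s.
Proof.
move=> rs Gx g /Gx[y gy xy]; exists y => //.
by apply: le_trans xy _; rewrite lee_fin.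
Qed.

Lemma approaches_near (R : realType) (A : gms R) (F G : set_system A) (x : A)
  (r s : R) : approaches F x r -> filter_near F G s -> approaches G x (r + s).
Proof.
move=> Fx FG g Gg; have [y yG xy] := Fx _ FG; have [z gz yz] := yG _ Gg.
by exists z => //; exact: gdist_triangle_le yz.
Qed.

Lemma filter_dist_le (R : realType) (A : gms R) (F G : set_system A) (r : R) :
  filter_near F G r -> filter_dist F G <= r%:E.
Proof. by move=> FG; apply: ereal_inf_lbound; exists r. Qed.

(** The bound is strict because the infimum need not be attained; later estimates reserve some slack
    for this. *)
Lemma filter_dist_lt (R : realType) (A : gms R) (F G : set_system A) (r : R) :
  Filter F -> filter_dist F G < r%:E -> filter_near F G r.
Proof.
move=> FF /ereal_inf_lt[_ [s FG <-]]; rewrite lte_fin => /ltW sr.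
by apply: filterS FG => x; exact: approaches_le.
Qed.

Lemma filter_dist_ge0 (R : realType) (A : gms R) (F G : set_system A) :
  ProperFilter F -> ProperFilter G -> 0 <= filter_dist F G.
Proof.
move=> PF PG; apply: le_ereal_inf_tmp => _ [r /filter_ex[x xG] <-].
by have [y _] := xG _ filterT; apply: le_trans; exact: gdist_ge0.
Qed.

Lemma weakly_flat_near (R : realType) (A : gms R) (F : set_system A) (e : R) :
  Filter F -> weakly_flat F -> (0 < e)%R -> filter_near F F e.
Proof.
move=> FF flF /flF[f Ff fP]; apply: filterS Ff => x fx g; exact: fP.
Qed.

Lemma filter_dist_xx (R : realType) (A : gms R) (F : set_system A) :
  ProperFilter F -> weakly_flat F -> filter_dist F F = 0.
Proof.
move=> PF flF; apply/eqP; rewrite eq_le filter_dist_ge0 // andbT.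
apply: lee_of_lt_fin => r; rewrite lte_fin => r0.
by apply: filter_dist_le; exact: weakly_flat_near.
Qed.

Lemma filter_dist_triangle (R : realType) (A : gms R) (F G H : set_system A) :
  ProperFilter F -> ProperFilter G -> ProperFilter H ->
  filter_dist F H <= filter_dist G H + filter_dist F G.
Proof.
move=> PF PG PH.
have := filter_dist_ge0 PF PG; have := filter_dist_ge0 PG PH.
have FGP := @filter_dist_lt _ _ F G _ _.
have GHP := @filter_dist_lt _ _ G H _ _.
case: (filter_dist F G) FGP => [s| |] // FGP; last first.
  by case: (filter_dist G H) => [t| |] // _ _; exact: leey.
case: (filter_dist G H) GHP => [t| |] // GHP; last by move=> _ _; exact: leey.
move=> t0 s0; apply: lee_of_lt_fin => r; rewrite -EFinD lte_fin => tsr.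
(* Half of the slack goes to each of the two nearness relations, which require strict bounds. *)
pose e := ((r - (t + s)) / 2)%R.
have re : r = (s + e + (t + e))%R by rewrite /e; lra.
have e0 : (0 < e)%R by rewrite /e; lra.
apply: filter_dist_le; rewrite re.
have FG : filter_near F G (s + e) by apply: FGP; rewrite lte_fin; lra.
apply: filterS FG => x xG; apply: approaches_near xG _.
by apply: GHP; rewrite lte_fin; lra.
Qed.

(** * The space of flat filters *)

(* [weakly_flat] follows from [flat_arity N] when [N 1]; including it makes
   [filter_dist] vanish on the diagonal for arbitrary [N]. *)
Definition flat_filter (R : realType) (N : set nat) (A : gms R) : Type :=
  {F : set_system A | ProperFilter F /\ flat_arity N F /\ weakly_flat F}.

Lemma flat_filter_proper (R : realType) (N : set nat) (A : gms R)
  (X : flat_filter N A) : ProperFilter (sval X).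
Proof. exact: (svalP X).1. Qed.
#[local] Hint Extern 0 (ProperFilter (sval _)) =>
  solve [apply: flat_filter_proper] : typeclass_instances.

Lemma flat_filter_weakly_flat (R : realType) (N : set nat) (A : gms R)
  (X : flat_filter N A) : weakly_flat (sval X).
Proof. exact: (svalP X).2.2. Qed.

Definition completion (R : realType) (N : set nat) (A : gms R) : gms R :=
  @Gms R (flat_filter N A) (fun X Y => filter_dist (sval X) (sval Y))
    (fun X Y => filter_dist_ge0 (flat_filter_proper X) (flat_filter_proper Y))
    (fun X => filter_dist_xx (flat_filter_proper X) (flat_filter_weakly_flat X))
    (fun X Y Z => filter_dist_triangle (flat_filter_proper X)
       (flat_filter_proper Y) (flat_filter_proper Z)).

Lemma completion_near (R : realType) (N : set nat) (A : gms R)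
  (X Y : completion N A) (r e : R) : gdist X Y <= r%:E -> (r < e)%R ->
  filter_near (sval X) (sval Y) e.
Proof.
move=> XY re; apply: filter_dist_lt.
by apply: le_lt_trans XY _; rewrite lte_fin.
Qed.

(** * The embedding by principal filters *)

Lemma principal_filter_flat (R : realType) (N : set nat) (A : gms R) (x : A) :
  flat_arity N (principal_filter x).
Proof.
move=> e e0; exists [set x] => // n y g _ yx /principal_filterP gx.
exists x => // i.
by rewrite yx gdist_xx lee_fin ltW.
Qed.

Lemma principal_filter_weakly_flat (R : realType) (A : gms R) (x : A) :
  weakly_flat (principal_filter x).
Proof.
by rewrite flat_arity_set1; exact: principal_filter_flat.
Qed.

Definition embed (R : realType) (N : set nat) (A : gms R) (x : A) :
    completion N A :=
  exist _ (principal_filter x) (conj (principal_filter_proper x)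
    (conj (@principal_filter_flat R N A x) (principal_filter_weakly_flat x))).

(** Ensures that a value prescribed at [embed x] is unambiguous, even when distinct points of [A]
    are at distance 0. *)
Lemma embed_inj (R : realType) (N : set nat) (A : gms R) :
  injective (@embed R N A).
Proof.
move=> x y /(congr1 sval) /= xy.
have : principal_filter x [set y] by rewrite xy; apply/principal_filterP.
by move=> /principal_filterP.
Qed.

Lemma filter_near_principal (R : realType) (A : gms R) (x : A)
  (G : set_system A) (r : R) :
  filter_near (principal_filter x) G r <-> approaches G x r.
Proof. exact: principal_filterP. Qed.

Lemma embed_nonexpansive (R : realType) (N : set nat) (A : gms R) :
  nonexpansive (@embed R N A).
Proof.
move=> x y; apply: lee_of_lt_fin => r xy; apply: filter_dist_le.
apply/filter_near_principal => g /principal_filterP gy.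
by exists y => //; exact: ltW.
Qed.

(** Nearness of [embed x] to [Y] is approach of [Y] by [x], so both bounds reduce to the definition
    of [filter_dist]. This is what forces uniqueness of extensions. *)
Lemma embed_representative (R : realType) (N : set nat) (A : gms R)
  (X : completion N A) :
  representative (image_filter (@embed R N A) (sval X)) X.
Proof.
apply/image_filter_representative; split=> [Y r XY | Y r f Xf fr].
  exists [set x | approaches (sval Y) x r]; first exact: filter_dist_lt.
  by move=> x xY; apply: filter_dist_le; apply/filter_near_principal.
apply: lee_of_lt_fin => s; rewrite lte_fin => rs; apply: filter_dist_le.
by apply: filterS Xf => x /fr /completion_near/(_ rs)/filter_near_principal.
Qed.

(** * Limits of filters of filters *)

Definition limit_core (R : realType) (N : set nat) (A : gms R)
    (Phi : set_system (completion N A)) (e : R) : set A :=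
  [set x | forall phi, Phi phi ->
     exists2 X : completion N A, phi X & approaches (sval X) x e].

Definition limit_filter (R : realType) (N : set nat) (A : gms R)
    (Phi : set_system (completion N A)) : set_system A :=
  filter_from [set e : R | (0 < e)%R] (limit_core Phi).

(** Weak flatness of [X] lets its points approach [X], and weak flatness of [Phi] leads from [X]
    into any [psi]. Each costs [e / 3]; the last third is the slack of [completion_near]. *)
Lemma limit_core_mem (R : realType) (N : set nat) (A : gms R)
  (Phi : set_system (completion N A)) (e : R) :
  weakly_flat Phi -> (0 < e)%R ->
  exists2 phi, Phi phi & forall X, phi X -> sval X (limit_core Phi e).
Proof.
move=> flPhi e0; have e30 : (0 < e / 3)%R by lra.
have [phi Phiphi phiP] := flPhi _ e30; exists phi => // X phiX.
apply: filterS (weakly_flat_near _ (flat_filter_weakly_flat X) e30) => x xX psi.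
move=> /(phiP _ _ phiX) [Y psiY XY]; exists Y => //.
have -> : e = (e / 3 + (e / 3 + e / 3))%R by lra.
by apply: approaches_near xX _; apply: completion_near XY _; lra.
Qed.

Lemma limit_filter_proper (R : realType) (N : set nat) (A : gms R)
  (Phi : set_system (completion N A)) : ProperFilter Phi ->
  weakly_flat Phi -> ProperFilter (limit_filter Phi).
Proof.
move=> PPhi flPhi; apply: filter_from_proper; last first.
  move=> e e0; have [phi /filter_ex[X phiX] phiP] := limit_core_mem flPhi e0.
  exact: filter_ex (phiP _ phiX).
apply: filter_from_filter; first by exists 1%R => /=; exact: ltr01.
move=> d e /= d0 e0; exists (Num.min d e); first by rewrite lt_min d0.
move=> x xP; split => phi /xP[X phiX xX]; exists X => //;
  by apply: approaches_le xX; rewrite ge_min lexx ?orbT.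
Qed.

(** Flatness is used at two levels: in [Phi] it brings the filters [X i] near one [Y], and in [Y] it
    brings the points [y i] near one [z]. *)
Lemma limit_filter_flat (R : realType) (N : set nat) (A : gms R)
  (Phi : set_system (completion N A)) : Filter Phi ->
  weakly_flat Phi -> flat_arity N Phi -> flat_arity N (limit_filter Phi).
Proof.
move=> FPhi wflPhi flPhi e e0; have d0 : (0 < e / 4)%R by lra.
set d := (e / 4)%R in d0.
exists (limit_core Phi d); first by exists d.
move=> n x g Nn xP [c c0 cg]; have [phi Phiphi phiP] := flPhi _ d0.
have /choice[X XP] : forall i, exists Y : completion N A,
    phi Y /\ approaches (sval Y) (x i) d.
  by move=> i; have [Y] := xP i _ Phiphi; exists Y.
(* Every filter in [psi] has [limit_core Phi c] as a member, so [z] can be sought there and hence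
   inside [g]. *)
have [psi Phipsi psiP] := limit_core_mem wflPhi c0.
have [Y psiY XY] := phiP n X _ Nn (fun i => (XP i).1) Phipsi.
have [f Yf fP] := (svalP Y).2.1 _ d0.
have /choice[y yP] : forall i, exists z,
    f z /\ gdist (x i) z <= (d + (d + d))%:E.
  move=> i.
  have Yi : approaches (sval Y) (x i) (d + (d + d)).
    apply: approaches_near (XP i).2 _; apply: completion_near (XY i) _.
    by lra.
  by have [z] := Yi _ Yf; exists z.
have [z zc yz] := fP n y _ Nn (fun i => (yP i).1) (psiP _ psiY).
exists z; first exact: cg.
(* One [d] from [x i] to [X i], two from [X i] to [Y] with slack, one from [y i] to [z]. *)
move=> i; have -> : e = (d + (d + d) + d)%R by rewrite /d; lra.
exact: gdist_triangle_le (yP i).2 (yz i).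
Qed.

(** If [L] is near [Y], some core consists of points approaching [Y], and that core is a member of
    every [X] in some [phi]. Conversely, a point of a core approaches some [X] in [phi], and then
    [Y] through [X]. *)
Lemma limit_filter_representative (R : realType) (N : set nat) (A : gms R)
  (Phi : set_system (completion N A)) (L : completion N A) :
  Filter Phi -> weakly_flat Phi -> sval L = limit_filter Phi ->
  representative Phi L.
Proof.
move=> FPhi flPhi LE; apply/representativeP.
split=> [Y r LY | Y r phi Phiphi phir].
  have : filter_near (sval L) (sval Y) r by exact: filter_dist_lt.
  rewrite LE => -[e e0 eP]; have [phi Phiphi phiP] := limit_core_mem flPhi e0.
  exists phi => // X /phiP Xe; apply: filter_dist_le; exact: filterS Xe.
apply: lee_of_lt_fin => s; rewrite lte_fin => rs; apply: filter_dist_le.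
pose e := ((s - r) / 2)%R; have e0 : (0 < e)%R by rewrite /e; lra.
rewrite /filter_near LE; exists e => // x /(_ _ Phiphi) [X /phir Xr xX].
have -> : s = (e + (r + e))%R by rewrite /e; lra.
by apply: approaches_near xX _; apply: completion_near Xr _; lra.
Qed.

Lemma limit_exists (R : realType) (N : set nat) (A : gms R)
  (Phi : set_system (completion N A)) : N 1%N -> ProperFilter Phi ->
  flat_arity N Phi -> exists L : completion N A, sval L = limit_filter Phi.
Proof.
move=> N1 PPhi flPhi; have wflPhi := flat_arity_weakly_flat N1 flPhi.
have PL := limit_filter_proper PPhi wflPhi.
have flL : flat_arity N (limit_filter Phi) by exact: limit_filter_flat.
by exists (exist _ (limit_filter Phi)
  (conj PL (conj flL (flat_arity_weakly_flat N1 flL))) : flat_filter N A).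
Qed.

Lemma completion_complete (R : realType) (N : set nat) (A : gms R) :
  N 1%N -> complete_arity N (completion N A).
Proof.
move=> N1 Phi PPhi flPhi; have [L LE] := limit_exists N1 PPhi flPhi.
exists L; apply: limit_filter_representative => //.
exact: flat_arity_weakly_flat flPhi.
Qed.

(** * Extending maps to the completion *)

(* [B] is not assumed separated, so the representative chosen for the image of
   a principal filter has to be overridden to get [h (embed x) = f x]. *)
Lemma extension_exists (R : realType) (N : set nat) (A B : gms R) (f : A -> B) :
  complete_arity N B -> nonexpansive f ->
  exists h : completion N A -> B,
    (forall X, representative (image_filter f (sval X)) (h X)) /\
    (forall x, h (embed N x) = f x).
Proof.
move=> compB nef.
(* The value forced at principal filters is part of the choice predicate, so one choice function
   serves both conclusions. *)
have /choice[h hP] : forall X : completion N A, exists b,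
    representative (image_filter f (sval X)) b /\
    (forall x, X = embed N x -> b = f x).
  move=> X; have [[x ->]|nX] := pselect (exists x, X = embed N x).
    exists (f x); split => [|y /embed_inj -> //].
    apply/image_filter_representative; split=> [b r br | b r g].
      by exists [set x] => // _ ->; exact: ltW.
    by move=> /principal_filterP gx; exact.
  have [|b bP] := compB _ (image_filter_proper f (flat_filter_proper X)).
    exact: image_filter_flat (svalP X).2.1.
  by exists b; split => // x Xx; case: nX; exists x.
by exists h; split=> [X|x]; [exact: (hP X).1 | exact: (hP _).2].
Qed.

(** A point [x] of [X] approaching [Y] finds [y] where [f y] is already close to [h Y]; the bound on
    [f x] then passes to [h X]. *)
Lemma extension_nonexpansive (R : realType) (N : set nat) (A B : gms R)
  (f : A -> B) (h : completion N A -> B) : nonexpansive f ->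
  (forall X, representative (image_filter f (sval X)) (h X)) -> nonexpansive h.
Proof.
(* The second use of [lee_of_lt_fin] supplies the slack [s - r], spent between [f y] and [h Y]. *)
move=> nef hP X Y; apply: lee_of_lt_fin => r XY; apply: lee_of_lt_fin => s.
rewrite lte_fin => rs.
have [_ le_hX] := iffLR (image_filter_representative _ _ _) (hP X).
apply: (le_hX _ _ _ (filter_dist_lt _ XY)) => x xY.
have [ge_hY _] := iffLR (image_filter_representative _ _ _) (hP Y).
have [|g Yg gP] := ge_hY (h Y) (s - r)%R; first by rewrite gdist_xx lte_fin; lra.
have [y gy xy] := xY _ Yg; have -> : s = (r + (s - r))%R by lra.
by apply: gdist_triangle_le (gP _ gy); apply: le_trans (nef _ _) xy.
Qed.

(** One bound follows from nonexpansiveness, as filters in [Phi] come close to [X0]. For the other,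
    [X0] is replaced by the explicit limit [L], whose cores relate points of [A] to filters in
    [phi]. *)
Lemma extension_preserves_reps (R : realType) (N : set nat) (A B : gms R)
  (f : A -> B) (h : completion N A -> B) : N 1%N -> nonexpansive f ->
  (forall X, representative (image_filter f (sval X)) (h X)) ->
  preserves_reps_arity N h.
Proof.
move=> N1 nef hP Phi PPhi flPhi X0 repX0.
have wflPhi := flat_arity_weakly_flat N1 flPhi.
have neh := extension_nonexpansive nef hP.
have [L LE] := limit_exists N1 PPhi flPhi.
apply/image_filter_representative; split=> [b r X0b | b r phi Phiphi phir].
  have : 0 <= gdist (h X0) b by exact: gdist_ge0.
  (* The distance is nonnegative and below [r], hence real, and [r - s] is positive. *)
  case E : (gdist (h X0) b) X0b => [s| |] // + _; rewrite lte_fin => sr.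
  have [|phi Phiphi phiP] := representative_near (e := (r - s)%R) repX0.
    by lra.
  exists phi => // X /phiP XX0; have -> : r = ((r - s) + s)%R by lra.
  apply: (@gdist_triangle_le _ _ _ (h X0)); last by rewrite E.
  exact: le_trans (neh _ _) XX0.
(* [X0] and [L] both represent [Phi], so passing to [L] costs nothing. *)
have X0L : gdist (h X0) (h L) <= 0%:E.
  apply: le_trans (neh _ _) _; rewrite (representative_dist0 repX0) //.
  exact: limit_filter_representative.
rewrite -[r]add0r; apply: gdist_triangle_le X0L _.
apply: lee_of_lt_fin => s; rewrite lte_fin => rs.
pose e := ((s - r) / 2)%R; have e0 : (0 < e)%R by rewrite /e; lra.
have [_ le_hL] := iffLR (image_filter_representative _ _ _) (hP L).
apply: (le_hL _ _ (limit_core Phi e)); first by rewrite LE; exists e.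
move=> x /(_ _ Phiphi) [X /phir Xb xX].
have [ge_hX _] := iffLR (image_filter_representative _ _ _) (hP X).
have [|g Xg gP] := ge_hX b (r + e)%R.
  by apply: le_lt_trans Xb _; rewrite lte_fin; lra.
(* One [e] pays for the step from [x] to [y] in [X], the other for the strict bound at [h X]. *)
have [y gy xy] := xX _ Xg; have -> : s = (e + (r + e))%R by rewrite /e; lra.
by apply: gdist_triangle_le (gP _ gy); apply: le_trans (nef _ _) xy.
Qed.

(** [X] represents its own image under [embed], so [g X] represents the image of that filter under
    [g]. As [g] extends [f], this makes [g X] and [h X] representatives of the same filter on
    [B]. *)
Lemma extension_unique (R : realType) (N : set nat) (A B : gms R)
  (f : A -> B) (h g : completion N A -> B) :
  (forall X, representative (image_filter f (sval X)) (h X)) ->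
  preserves_reps_arity N g -> (forall x, g (embed N x) = f x) ->
  map_equiv g h.
Proof.
move=> hP gP gf X.
have repg : representative (image_filter f (sval X)) (g X).
  have : representative (image_filter g (image_filter (@embed R N A) (sval X)))
           (g X).
    apply: gP (embed_representative X).
      exact: image_filter_proper.
    exact: image_filter_flat (@embed_nonexpansive R N A) (svalP X).2.1.
  move=> /image_filter_representative [ge_gX le_gX].
  apply/image_filter_representative; split=> [b r | b r t Xt tP].
    move=> /ge_gX [T [t Xt tT] TP]; exists t => // x tx.
    by rewrite -gf; apply: TP; apply: tT; exists x.
  apply: (le_gX _ _ (@embed R N A @` t)); first by exists t.
  by move=> _ [x tx <-]; rewrite gf; exact: tP.
split; first exact: representative_dist0 repg (hP X).
exact: representative_dist0 (hP X) repg.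
Qed.

(** * The universal property *)

Lemma free_completion (R : realType) (N : set nat) (A : gms R) : N 1%N ->
  exists (Abar : gms R) (iA : A -> Abar),
    [/\ complete_arity N Abar,
        nonexpansive iA &
        forall (B : gms R) (f : A -> B), complete_arity N B -> nonexpansive f ->
          exists fbar : Abar -> B,
            [/\ nonexpansive fbar,
                preserves_reps_arity N fbar,
                forall x, fbar (iA x) = f x &
                forall g : Abar -> B,
                  nonexpansive g -> preserves_reps_arity N g ->
                  (forall x, g (iA x) = f x) -> map_equiv g fbar]].
Proof.
move=> N1; exists (completion N A), (@embed R N A); split.
- exact: completion_complete.
- exact: embed_nonexpansive.
move=> B f compB nef; have [h [hP hf]] := extension_exists compB nef.
exists h; split => //.
- exact: extension_nonexpansive hP.
- exact: extension_preserves_reps hP.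
- by move=> g _ gP gf; exact: extension_unique gP gf.
Qed.

Theorem theorem3p50 (R : realType) (A : gms R) :
  (exists (Abar : gms R) (iA : A -> Abar),
    [/\ P1_complete Abar,
        nonexpansive iA &
        forall (B : gms R) (f : A -> B), P1_complete B -> nonexpansive f ->
          exists fbar : Abar -> B,
            [/\ nonexpansive fbar,
                preserves_weakly_flat_reps fbar,
                forall x, fbar (iA x) = f x &
                forall g : Abar -> B,
                  nonexpansive g -> preserves_weakly_flat_reps g ->
                  (forall x, g (iA x) = f x) -> map_equiv g fbar]])
  /\
  (exists (Abar : gms R) (iA : A -> Abar),
    [/\ P2_complete Abar,
        nonexpansive iA &
        forall (B : gms R) (f : A -> B), P2_complete B -> nonexpansive f ->
          exists fbar : Abar -> B,
            [/\ nonexpansive fbar,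
                preserves_flat_reps fbar,
                forall x, fbar (iA x) = f x &
                forall g : Abar -> B,
                  nonexpansive g -> preserves_flat_reps g ->
                  (forall x, g (iA x) = f x) -> map_equiv g fbar]]).
Proof.
(* Unfolding exposes [weakly_flat] and [flat]; once these are rewritten, both halves are instances
   of [free_completion] up to conversion. *)
split; rewrite /P1_complete /P2_complete /preserves_weakly_flat_reps
  /preserves_flat_reps.
  by rewrite flat_arity_set1; exact: free_completion.
by rewrite flat_arity_setT; exact: free_completion.
Qed.
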